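(* Let $Q,Q'$ be two non-zero irreducible monomial ideals of $S=K[x_1,\ldots,x_n]$ such that $\sqrt{Q}=(x_1,\ldots,x_t)$ and $\sqrt{Q'}=(x_{r+1},\ldots,x_p)$ for some integers $r,t,p$ with $1\leq r\leq t<p\leq n$, or $0=r<t<p\leq n$, or $1\leq r\leq t=p\leq n$. Suppose that $p=n$. Then $$\operatorname{sdepth}(Q\cap Q')\geq \left\lceil\frac{r}{2}\right\rceil+\left\lceil\frac{n-t}{2}\right\rceil.$$
   Context: $K$ is a field and $S=K[x_1,\ldots,x_n]$ with its standard $\mathbb{Z}^n$-grading (multigrading). A monomial ideal is irreducible if it is generated by powers of some of the variables. For a finitely generated multigraded $S$-module $M$, a homogeneous element $z\in M$ and $Z\subseteq\{x_1,\ldots,x_n\}$, let $zK[Z]\subset M$ be the $K$-subspace of all elements $zf$, $f\in K[Z]$; it is called a Stanley space of dimension $|Z|$ if it is a free $K[Z]$-module. A Stanley decomposition of $M$ is a presentation of the $K$-vector space $M$ as a finite direct sum of Stanley spaces $\mathcal{D}: M=\bigoplus_{i=1}^s z_iK[Z_i]$. Set $\operatorname{sdepth}\mathcal{D}=\min\{|Z_i|: i=1,\ldots,s\}$, and $\operatorname{sdepth}_S(M)=\operatorname{sdepth}(M)=\max\{\operatorname{sdepth}\mathcal{D}:\mathcal{D}\text{ a Stanley decomposition of }M\}$ (the Stanley depth of $M$). $\lceil a\rceil$ is the smallest integer $\geq a$. *)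

(* Defs.v *)
From mathcomp Require Import all_boot all_order all_algebra.
From mathcomp Require Import boolp classical_sets.
From mathcomp Require Import mpoly.

Set Implicit Arguments.
Unset Strict Implicit.
Unset Printing Implicit Defensive.

Import Order.TTheory GRing.Theory Num.Theory.

Local Open Scope classical_set_scope.
Local Open Scope ring_scope.

(* The variable x_j of S = K[x_1, ..., x_n] is 'X_i with i = j - 1 : 'I_n,
   since ordinals start at 0. *)

Section MonomialIdeals.
Variables (K : fieldType) (n : nat).
Local Notation S := {mpoly K[n]}.

Definition ideal_span (G : set S) : set S :=
  [set f | exists (k : nat) (a g : 'I_k -> S),
             (forall i, G (g i)) /\ f = \sum_(i < k) a i * g i].

Definition radical (I : set S) : set S :=
  [set f | exists k : nat, I (f ^+ k.+1)].

(* The ideal (x_i : i \in A). *)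
Definition var_ideal (A : {set 'I_n}) : set S :=
  ideal_span [set g | exists2 i, i \in A & g = 'X_i].

(* Exponents are positive, so the unit ideal is excluded; A = set0 gives the
   zero ideal. *)
Definition irreducible_monomial_ideal (I : set S) : Prop :=
  exists (A : {set 'I_n}) (e : 'I_n -> nat),
    (forall i, i \in A -> (0 < e i)%N) /\
    I = ideal_span [set g | exists2 i, i \in A & g = 'X_i ^+ e i].

End MonomialIdeals.

Section StanleyDepth.
Variables (K : fieldType) (n : nat).
Local Notation S := {mpoly K[n]}.

(* f lies in the component of degree a of the Z^n-grading of S. *)
Definition in_multidegree (a : 'I_n -> int) (f : S) : Prop :=
  forall m, m \in msupp f -> forall i, (m i)%:Z = a i.

Definition multihomogeneous (f : S) : Prop := exists a, in_multidegree a f.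

(* The subalgebra K[Z] of S. *)
Definition poly_in (Z : {set 'I_n}) : set S :=
  [set f | forall m, m \in msupp f -> forall i, i \notin Z -> m i = 0%N].

Definition zspace (z : S) (Z : {set 'I_n}) : set S :=
  [set z * f | f in poly_in Z].

(* zK[Z] is a Stanley space of dimension #|Z|: it lies in M and is free over
   K[Z] with basis z. The trivial space 0 = 0K[Z] is thus not a Stanley
   space. *)
Definition stanley_space (M : set S) (z : S) (Z : {set 'I_n}) : Prop :=
  [/\ M z, multihomogeneous z, zspace z Z `<=` M &
      forall f g, poly_in Z f -> poly_in Z g -> z * f = z * g -> f = g].

(* M is a multigraded submodule of S, i.e. a monomial ideal, and
   M = \bigoplus_(i < s) z_i K[Z_i] as a K-vector space: the terms are in M,
   and every element of M is in a unique way a sum of elements of the terms. *)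
Definition stanley_decomposition (M : set S) (s : nat)
    (z : 'I_s -> S) (Z : 'I_s -> {set 'I_n}) : Prop :=
  (forall i, stanley_space M (z i) (Z i)) /\
  (forall f, M f -> exists! w : {ffun 'I_s -> S},
     (forall i, zspace (z i) (Z i) (w i)) /\ f = \sum_(i < s) w i).

(* Since #|Z i| <= n, the neutral value n does not affect the minimum unless
   s = 0, that is unless M = 0. *)
Definition sdepth_decomposition (s : nat) (Z : 'I_s -> {set 'I_n}) : nat :=
  \big[minn/n]_(i < s) #|Z i|.

(* The maximum runs over the values d taken by sdepth_decomposition, all of
   which are at most n. *)
Definition sdepth (M : set S) : nat :=
  \max_(d < n.+1 | `[< exists (s : nat) (z : 'I_s -> S)
                              (Z : 'I_s -> {set 'I_n}),
                         stanley_decomposition M z Z /\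
                         sdepth_decomposition Z = d >]) d.

End StanleyDepth.

(* Main.v *)
Require Import Defs.
From mathcomp Require Import all_boot all_order all_algebra.
From mathcomp Require Import boolp classical_sets.
From mathcomp Require Import mpoly.
From mathcomp Require Import zify.

(** Write [A], [B], [C] for the variables that occur in [Q] only, in both ideals
    and in [Q'] only: [r], [t - r] and [n - t] of them.  Both ideals are monomial,
    so a Stanley decomposition of their intersection is obtained from a finite
    partition of its set of monomials into cones, a cone being the set of
    multiples of a monomial [b] by monomials in a set [Z] of variables; it gives
    the Stanley space [bK[Z]] ([stanley_decomposition_cones]).

    The space of exponents of the variables [B] is cut by a grid into finitely many
    cells, fine enough for membership in [Q] or in [Q'] due to a variable of [B] to
    be constant on each cell ([meets_grid]).  Over a cell that already lies in [Q]
    the exponents of [A] are unconstrained; over another cell, some exponent of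
    [A] must reach its bound.  The same holds for [Q'] and [C].  Hence everything
    follows from the case of one irreducible ideal: if [k] variables are given
    bounds [e_i], the exponent vectors [u] with [e_i <= u_i] for some [i] can be
    partitioned into cones of dimension at least [k / 2].  The products of cones
    over [A], [B] and [C] then have dimension at least
    [uphalf r + uphalf (n - t)].

    For one irreducible ideal, replace [u] by the bit string of the truth values of
    [e_i <= u_i]: an interval of the lattice of bit strings, written as a word in
    the letters [0], [1] and [*] (either bit), pulls back to a disjoint union of
    cones whose dimension is the number of letters other than [0].  So the nonzero
    bit strings of length [k] have to be partitioned by words in which at most half
    of the letters are [0].  Number the positions from [0].  The strings whose
    first [1] is in an even position are partitioned by the words that consist of
    an odd number of blocks [*0*0...*01], followed by [*0*0...*0] or by
    [*0*0...*0*] (any of the repetitions may be empty): in these words the letters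
    other than [0] are the majority, since each block has one more of them than it
    has letters [0].  The strings whose first [1] is in an odd position are [0]
    followed by a string of the first kind, so prefixing a [0] deals with them
    without losing more than the majority ([covering_alternating],
    [alternating_dim], [irreducible_cones]).

    That the words with an odd number of blocks form a partition is proved by
    induction on the length together with the companion statement for an even
    number of blocks, whose words partition the strings that are zero or have their
    first [1] in an even position. *)

Set Implicit Arguments.
Unset Strict Implicit.
Unset Printing Implicit Defensive.

Import Order.TTheory GRing.Theory Num.Theory.

Local Open Scope classical_set_scope.
Local Open Scope ring_scope.

(** * Cones of exponent vectors *)

Section Cones.
Local Open Scope nat_scope.

(** A factor [(v, false)] stands for the point [v], a factor [(v, true)] for the
    half-line of the exponents [>= v]; a cone is a product of such factors. *)
Definition cone := seq (nat * bool).

Definition in_factor (k : nat * bool) (x : nat) : bool :=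
  if k.2 then k.1 <= x else x == k.1.

Definition in_cone (c : cone) (u : seq nat) : bool := all2 in_factor c u.

Definition cone_dim (c : cone) : nat := count snd c.

(** Counting the cones of [D] that contain [u], rather than stating existence and
    uniqueness, turns partitions into identities between natural numbers: unions
    become sums and products of cones become products. *)
Definition covering (D : seq cone) (u : seq nat) : nat :=
  count (in_cone^~ u) D.

Lemma covering_cat D1 D2 u :
  covering (D1 ++ D2) u = covering D1 u + covering D2 u.
Proof. exact: count_cat. Qed.

Lemma covering_cons k D x u :
  covering [seq k :: c | c <- D] (x :: u) = in_factor k x * covering D u.
Proof.
rewrite /covering count_map.
case E: (in_factor k x); last first.
  by rewrite mul0n (eq_count (a2 := pred0)) ?count_pred0 // => c /=; rewrite E.
by rewrite mul1n; apply: eq_count => c /=; rewrite E.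
Qed.

Definition slices (a : nat) (D : seq cone) : seq cone :=
  [seq (v, false) :: c | v <- iota 0 a, c <- D].

Lemma covering_slices a D x u :
  covering (slices a D) (x :: u) = (x < a) * covering D u.
Proof.
have -> : (x < a) = count_mem x (iota 0 a) :> nat.
  by rewrite count_uniq_mem ?iota_uniq // mem_iota add0n.
rewrite /slices; elim: (iota 0 a) => [//|v s IHs] /=.
by rewrite covering_cat IHs covering_cons /in_factor /= mulnDl (eq_sym x).
Qed.


(** * Partitioning the exponents of an irreducible ideal *)

Definition reaches (p : nat * nat) : bool := p.1 <= p.2.

Definition meets (e u : seq nat) : bool := has reaches (zip e u).

Definition lead (e u : seq nat) : nat := find reaches (zip e u).

(** The words with an odd ([b = true]) or even ([b = false]) number of blocks
    [*0*0...*01] and a tail [*0*0...*0] or [*0*0...*0*], pulled back to exponent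
    vectors: with bound [a], the letter [1] is the half-line [>= a], the letter [*]
    the half-line [>= 0], and the letter [0] is split into the points below [a].
    A word begins with [1], which closes a block, or with [*0], or is the final
    [*]. *)
Fixpoint alternating (b : bool) (e : seq nat) : seq cone :=
  match e with
  | [::] => if b then [::] else [:: [::]]
  | a :: e1 =>
    [seq (a, true) :: c | c <- alternating (~~ b) e1] ++
    match e1 with
    | [::] => if b then [::] else [:: [:: (0, true)]]
    | a1 :: e2 => [seq (0, true) :: c | c <- slices a1 (alternating b e2)]
    end
  end.

(** Let [u] have bits [w], and suppose the first [1] of [w] is at position [0], say
    [w = 1v].  A word beginning with [1] that contains [w] continues with a word
    of the opposite parity containing [v]; a word beginning with [*0] requires
    [v = 0v'] and continues with a word of the same parity containing [v'].  By
    induction the first possibility occurs, for an odd number of blocks, exactly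
    when [v] is zero or has its first [1] in an even position, and the second one
    when [v] has its first [1] in an odd position.  For an even number of blocks
    the zero string moves to the second possibility.  Either way exactly one of
    the two occurs, once.  If [w] begins with [0], only words beginning with [*0]
    or the word [*] can contain it, and removing [*0] moves positions by two. *)
Lemma covering_alternating b e u : size u = size e ->
  covering (alternating b e) u =
  (if b then meets e u && ~~ odd (lead e u)
   else meets e u ==> ~~ odd (lead e u)).
Proof.
(* A word starts with one letter or with two, so the induction carries the
   statement for two consecutive lengths. *)
suff: (forall b u, size u = size e -> covering (alternating b e) u =
         (if b then meets e u && ~~ odd (lead e u)
          else meets e u ==> ~~ odd (lead e u))) /\
      (forall a b u, size u = size (a :: e) ->
         covering (alternating b (a :: e)) u =
         (if b then meets (a :: e) u && ~~ odd (lead (a :: e) u)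
          else meets (a :: e) u ==> ~~ odd (lead (a :: e) u))).
  by case=> + _; apply.
elim: e {b u} => [|a1 e [IH IH1]]; split.
- by case=> - [].
- move=> a [] [|x [|]] //= _; rewrite /meets /lead /= /reaches /in_factor /=;
  by rewrite /covering /=; case: (a <= x).
- exact: IH1.
move=> a b [|x [|x1 u]] // [su].
have su1 : size (x1 :: u) = size (a1 :: e) by rewrite /= su.
rewrite [alternating _ _]/= covering_cat !covering_cons covering_slices.
rewrite IH // -[_ ++ _]/(alternating (~~ b) (a1 :: e)) IH1 //.
rewrite /meets /lead /= /in_factor /reaches /=.
rewrite ltnNge; case: (a <= x); case: (a1 <= x1); case: b => //=;
  by case: (has _ _); case: (odd _).
Qed.

(** Each block has one more letter different from [0] than letters [0], and the
    tail has at least as many; with an odd number of blocks there is at least one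
    block, hence the summand [b]. *)
Lemma alternating_dim b e c : c \in alternating b e ->
  size c = size e /\ size e + b <= (cone_dim c).*2.
Proof.
suff: (forall b c, c \in alternating b e ->
         size c = size e /\ size e + b <= (cone_dim c).*2) /\
      (forall a b c, c \in alternating b (a :: e) ->
         size c = size (a :: e) /\ size (a :: e) + b <= (cone_dim c).*2).
  by case=> + _; apply.
elim: e {b c} => [|a1 e [IH IH1]]; split.
- by case=> c //=; rewrite inE => /eqP ->.
- by move=> a [] c //=; rewrite inE => /eqP ->.
- exact: IH1.
move=> a b c; rewrite [alternating _ _]/= mem_cat => /orP[] /mapP[d].
  move=> /IH1[sd dd] ->; rewrite /= sd; split=> //.
  by rewrite /cone_dim /= -/(cone_dim d); move: dd => /=; case: b => /=; lia.
case/allpairsP=> - [v d'] /= [_ /IH[sd dd] ->] ->; split; first by rewrite /= sd.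
by rewrite /cone_dim /= -/(cone_dim d'); lia.
Qed.

(** The first coordinate that reaches its bound is in an even position, or its
    position becomes even once the first coordinate, which is below its bound, is
    removed. *)
Definition irreducible_cones (e : seq nat) : seq cone :=
  alternating true e ++
  (if e is a :: e1 then slices a (alternating true e1) else [::]).

Lemma covering_irreducible e u : size u = size e ->
  covering (irreducible_cones e) u = meets e u.
Proof.
case: e u => [|a e] [|x u] // [su].
rewrite covering_cat covering_slices !covering_alternating //= ?su //.
rewrite /meets /lead /= /reaches /= ltnNge.
by case: (a <= x) => //=; case: (has _ _); case: (odd _).
Qed.

Lemma irreducible_cones_dim e c : c \in irreducible_cones e ->
  size c = size e /\ size e <= (cone_dim c).*2.
Proof.
rewrite mem_cat => /orP[/alternating_dim[-> ]|]; first by split=> //; lia.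
case: e => [//|a e] /allpairsP[[v d] /= [_ /alternating_dim[sd dd] ->]] /=.
by rewrite sd /cone_dim /= -/(cone_dim d); split=> //; lia.
Qed.


(** * Combining the three groups of variables *)

Fixpoint grid (M : seq nat) : seq cone :=
  if M is a :: M1 then
    [seq (a, true) :: c | c <- grid M1] ++ slices a (grid M1)
  else [:: [::]].

Lemma covering_grid M u : size u = size M -> covering (grid M) u = 1.
Proof.
elim: M u => [|a M IH] [|x u] // [su].
rewrite covering_cat covering_cons covering_slices IH // /in_factor /=.
by rewrite ltnNge; case: (a <= x).
Qed.

Lemma size_grid M c : c \in grid M -> size c = size M.
Proof.
elim: M c => [|a M IH] c /=; first by rewrite inE => /eqP ->.
rewrite mem_cat => /orP[/mapP[d /IH sd ->]|]; first by rewrite /= sd.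
by case/allpairsP=> - [v d] /= [_ /IH sd ->]; rewrite /= sd.
Qed.

(** The base point [unzip1 c] of a cell decides for the whole cell: a factor of the
    cell is a single exponent, or a half-line that starts above the bounds
    [e <= M]. *)
Lemma meets_grid M e c u : c \in grid M -> size e = size M ->
  all2 leq e M -> in_cone c u -> meets e u = meets e (unzip1 c).
Proof.
move=> + se; elim: M e se c u => [|a M IH] [|a1 e] // se c u.
  by rewrite inE => /eqP -> _; case: u.
case: se => se.
rewrite [grid _]/= mem_cat => cM /= /andP[ea eM].
have {}cM : exists k d, [/\ d \in grid M, c = k :: d &
                         k = (a, true) \/ exists2 v, v < a & k = (v, false)].
  case/orP: cM => [/mapP[d dM ->]|]; first by exists (a, true), d; split; auto.
  case/allpairsP=> - [v d] /= [va dM ->]; exists (v, false), d.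
  by split=> //; right; exists v; rewrite // mem_iota in va.
case: cM => k [d [dM -> kE]]; case: u => [|x u] //= /andP[kx du].
rewrite /meets /= -/(meets e u) -/(meets e (unzip1 d)) (IH _ se _ _ dM) //.
congr (_ || _); rewrite /reaches /=; move: kx; rewrite /in_factor.
case: kE => [->|[v _ ->]] /=; last by move/eqP ->.
by move=> ax; rewrite ea (leq_trans ea).
Qed.

Definition full_cone (k : nat) : cone := nseq k (0, true).

Lemma in_full_cone k u : size u = k -> in_cone (full_cone k) u.
Proof. by move <-; elim: u. Qed.

Lemma full_cone_dim k : cone_dim (full_cone k) = k.
Proof. by rewrite /cone_dim count_nseq mul1n. Qed.

Lemma in_cone_cat c1 c2 u1 u2 : size c1 = size u1 ->
  in_cone (c1 ++ c2) (u1 ++ u2) = in_cone c1 u1 && in_cone c2 u2.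
Proof.
elim: c1 u1 => [|k c1 IH] [|x u1] //= [su].
by rewrite IH // andbA.
Qed.

Lemma covering_map_cat c D u1 u2 : size c = size u1 ->
  covering [seq c ++ d | d <- D] (u1 ++ u2) = in_cone c u1 * covering D u2.
Proof.
move=> sc; rewrite /covering count_map.
case E: (in_cone c u1); last first.
  rewrite mul0n (eq_count (a2 := pred0)) ?count_pred0 // => d /=.
  by rewrite in_cone_cat // E.
by rewrite mul1n; apply: eq_count => d /=; rewrite in_cone_cat // E.
Qed.

Lemma covering_allpairs_cat D1 D2 u1 u2 :
    (forall c, c \in D1 -> size c = size u1) ->
  covering [seq c1 ++ c2 | c1 <- D1, c2 <- D2] (u1 ++ u2) =
  covering D1 u1 * covering D2 u2.
Proof.
elim: D1 => [//|c D1 IH] sD /=.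
rewrite covering_cat IH => [|d dD]; last by rewrite sD // inE dD orbT.
by rewrite covering_map_cat ?sD ?mem_head // -mulnDl.
Qed.

(** The cones over the variables of one ideal alone, [b] telling whether the shared
    variables already put the monomial in that ideal. *)
Definition completing_cones (b : bool) (e : seq nat) : seq cone :=
  if b then [:: full_cone (size e)] else irreducible_cones e.

Lemma covering_completing b e u : size u = size e ->
  covering (completing_cones b e) u = b || meets e u.
Proof.
move=> su; rewrite /completing_cones; case: b; last exact: covering_irreducible.
by rewrite /covering /= in_full_cone.
Qed.

Lemma completing_cones_dim b e c : c \in completing_cones b e ->
  size c = size e /\ size e <= (cone_dim c).*2.
Proof.
rewrite /completing_cones; case: b; last exact: irreducible_cones_dim.
by rewrite inE => /eqP ->; rewrite full_cone_dim size_nseq; split=> //; lia.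
Qed.

Definition intersection_cones (eA eB eB' eC : seq nat) : seq cone :=
  flatten [seq [seq c1 ++ c2 | c1 <- completing_cones (meets eB (unzip1 g)) eA,
                  c2 <- [seq g ++ c3 |
                    c3 <- completing_cones (meets eB' (unzip1 g)) eC]]
          | g <- grid [seq maxn p.1 p.2 | p <- zip eB eB']].

Lemma covering_flatten T (F : T -> seq cone) (s : seq T) u :
  covering (flatten [seq F i | i <- s]) u = \sum_(i <- s) covering (F i) u.
Proof.
elim: s => [|i s IH] /=; first by rewrite big_nil.
by rewrite covering_cat big_cons IH.
Qed.

Lemma meets_cat e1 e2 u1 u2 : size e1 = size u1 ->
  meets (e1 ++ e2) (u1 ++ u2) = meets e1 u1 || meets e2 u2.
Proof. by move=> s1; rewrite /meets zip_cat // has_cat. Qed.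

Lemma all2_leq_maxl e e' : size e' = size e ->
  all2 leq e [seq maxn p.1 p.2 | p <- zip e e'].
Proof.
elim: e e' => [|a e IH] [|a' e'] //= [se].
by rewrite leq_maxl IH.
Qed.

Lemma all2_leq_maxr e e' : size e' = size e ->
  all2 leq e' [seq maxn p.1 p.2 | p <- zip e e'].
Proof.
elim: e e' => [|a e IH] [|a' e'] //= [se].
by rewrite leq_maxr IH.
Qed.

(** Every exponent vector of the shared variables lies in exactly one cell [g]; so
    only the summand of [g] survives, and there both memberships are read off from
    [g] and from the variables that are not shared. *)
Lemma covering_intersection eA eB eB' eC u : size eB' = size eB ->
    size u = size eA + (size eB + size eC) ->
  covering (intersection_cones eA eB eB' eC) u =
  meets (eA ++ eB) (take (size eA + size eB) u) &&
  meets (eB' ++ eC) (drop (size eA) u).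
Proof.
move=> sB su.
have [uA [uB [uC [-> sA sBu sC]]]] : exists uA uB uC,
    [/\ u = uA ++ uB ++ uC, size uA = size eA,
        size uB = size eB & size uC = size eC].
  exists (take (size eA) u), (take (size eB) (drop (size eA) u)),
         (drop (size eB) (drop (size eA) u)).
  by rewrite !cat_take_drop; split=> //; rewrite ?size_takel ?size_drop ?su; lia.
rewrite catA take_size_cat ?size_cat ?sA ?sBu // -catA drop_size_cat //.
rewrite !meets_cat ?sBu //.
rewrite /intersection_cones; set M := [seq maxn p.1 p.2 | p <- zip eB eB'].
have sM : size M = size eB by rewrite size_map size_zip sB minnn.
rewrite covering_flatten.
transitivity (\sum_(g <- grid M) in_cone g uB *
                ((meets eB uB || meets eA uA) * (meets eB' uB || meets eC uC))).
  apply: eq_big_seq => g gM.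
  rewrite covering_allpairs_cat; last first.
    by move=> c /completing_cones_dim[->].
  rewrite covering_map_cat ?(size_grid gM) ?sM // !covering_completing //.
  case E: (in_cone g uB); last by rewrite mul0n muln0.
  rewrite !mul1n (meets_grid gM _ (all2_leq_maxl sB) E) ?sM //.
  by rewrite (meets_grid gM _ (all2_leq_maxr sB) E) ?sM.
rewrite -big_distrl /=.
have -> : \sum_(g <- grid M) in_cone g uB = covering (grid M) uB.
  by rewrite /covering -sum1_count [in RHS]big_mkcond.
rewrite covering_grid ?sM // mul1n mulnb.
by rewrite [meets eB uB || _]orbC.
Qed.

Lemma intersection_cones_dim eA eB eB' eC c :
    size eB' = size eB -> c \in intersection_cones eA eB eB' eC ->
  size c = size eA + (size eB + size eC) /\
  uphalf (size eA) + uphalf (size eC) <= cone_dim c.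
Proof.
move=> sB /flatten_mapP[g /size_grid sg] /allpairsP[[c1 c2] /=].
case=> /completing_cones_dim[s1 d1] /mapP[c3 /completing_cones_dim[s3 d3] ->] ->.
rewrite /cone_dim !count_cat -!/(cone_dim _) !size_cat s1 s3 sg.
by rewrite size_map size_zip sB minnn; split=> //; lia.
Qed.

End Cones.

(** * From cones to Stanley decompositions *)

Section StanleySpaces.
Variables (K : fieldType) (n : nat).
Local Notation S := {mpoly K[n]}.
Implicit Types (m b : 'X_{1..n}) (f g : S) (c : cone) (D : seq cone).

Lemma zspace_monomialP b (Z : {set 'I_n}) f :
  zspace 'X_[b] Z f <->
  forall m, m \in msupp f -> (b <= m)%MM /\ forall i, i \notin Z -> m i = b i.
Proof.
split=> [[g gZ <-] m|fP].
  rewrite mulrC (perm_mem (msuppMX _ _)) => /mapP[m' m'g ->]; split.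
    exact: lem_addr.
  by move=> i iZ; rewrite mnmDE (gZ _ m'g _ iZ) addn0.
exists (\sum_(m <- msupp f) f@_m *: 'X_[m - b]).
  move=> m /msupp_sum_le /flatten_mapP[m']; rewrite filter_predT => m'f.
  move=> /msuppZ_le; rewrite msuppX inE => /eqP -> i iZ.
  by have [_ /(_ i iZ) mb] := fP _ m'f; rewrite mnmBE mb subnn.
rewrite mulr_sumr [RHS]mpolyE; apply: eq_big_seq => m mf.
by rewrite -scalerAr -mpolyXD addmC submK //; have [] := fP _ mf.
Qed.

Definition cone_base (c : cone) : 'X_{1..n} :=
  [multinom (nth (0%N, false) c i).1 | i < n].

Definition cone_vars (c : cone) : {set 'I_n} :=
  [set i : 'I_n | (nth (0%N, false) c i).2]%SET.

Lemma in_coneP c m : size c = n ->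
  reflect ((cone_base c <= m)%MM /\
           forall i, i \notin cone_vars c -> m i = cone_base c i)
          (in_cone c m).
Proof.
move=> sc; rewrite /in_cone all2E size_tuple sc eqxx /=.
have szip : size (zip c m) = n by rewrite size_zip sc size_tuple minnn.
have nth_cm (i : 'I_n) :
    nth ((0%N, false), 0%N) (zip c m) i = (nth (0%N, false) c i, m i).
  by rewrite nth_zip ?size_tuple // (mnm_nth 0).
apply: (iffP (all_nthP ((0%N, false), 0%N))) => [cm|[bm mb] i].
  have {}cm (i : 'I_n) : in_factor (nth (0%N, false) c i) (m i).
    by have := cm i; rewrite szip nth_cm; apply.
  split=> [|i]; last first.
    by rewrite inE mnmE; have := cm i; rewrite /in_factor; case: ifP => // _ /eqP.
  apply/mnm_lepP => i; rewrite mnmE; have := cm i; rewrite /in_factor.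
  by case: ifP => // _ /eqP ->.
rewrite szip => lt_in; rewrite (nth_cm (Ordinal lt_in)) /in_factor /=.
have := mnm_lepP bm (Ordinal lt_in); have := mb (Ordinal lt_in).
rewrite inE mnmE /=; case: ifP => // _ /(_ isT) -> _; exact: eqxx.
Qed.

Lemma zspace_cone c f : size c = n ->
  zspace 'X_[cone_base c] (cone_vars c) f <->
  forall m, m \in msupp f -> in_cone c m.
Proof.
move=> sc; rewrite zspace_monomialP; split=> fP m /fP; first by move/in_coneP->.
by move/(in_coneP _ sc).
Qed.

Lemma card_cone_vars c : size c = n -> #|cone_vars c| = cone_dim c.
Proof.
move=> sc; rewrite /cone_vars /cone_dim -sum1dep_card -sum1_count.
by rewrite (big_nth (0%N, false)) big_mkord sc.
Qed.

Lemma stanley_space_cone (M : set S) c : size c = n ->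
    (forall f, (forall m, m \in msupp f -> in_cone c m) -> M f) ->
  stanley_space M 'X_[cone_base c] (cone_vars c).
Proof.
move=> sc cM; split.
- apply: cM => m; rewrite msuppX inE => /eqP ->; apply/in_coneP => //.
  by split=> //; apply: lepm_refl.
- exists (fun i => (cone_base c i)%:Z) => m.
  by rewrite msuppX inE => /eqP ->.
- by move=> f /zspace_cone-/(_ sc)/cM.
- move=> f g _ _; apply: mulfI.
  by rewrite -msupp_eq0 msuppX.
Qed.

Definition msupp_part (P : pred 'X_{1..n}) f : S :=
  \sum_(m <- msupp f | P m) f@_m *: 'X_[m].

Lemma mcoeff_msupp_part P f m : (msupp_part P f)@_m = f@_m *+ P m.
Proof.
rewrite {2}[f]mpolyE /msupp_part !raddf_sum /= big_mkcond -sumrMnl /=.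
apply: eq_bigr => m' _; rewrite mcoeffZ mcoeffX.
have [->|_] := eqVneq m' m; last by rewrite mulr0 mul0rn if_same.
by rewrite mulr1 mulrb.
Qed.

Lemma covering_sum D u :
  covering D u = (\sum_(i < size D) in_cone (nth [::] D i) u)%N.
Proof.
by rewrite /covering -sum1_count (big_nth [::]) big_mkord [LHS]big_mkcond.
Qed.

(** The component of [f] in a Stanley space has to be the part of [f] supported in
    the corresponding cone, since no other cone contributes to these
    coefficients. *)
Lemma stanley_decomposition_cones (M : set S) (P : pred 'X_{1..n}) D :
    (forall f, M f <-> forall m, m \in msupp f -> P m) ->
    (forall c, c \in D -> size c = n) ->
    (forall m, covering D m = P m) ->
  stanley_decomposition M (fun i : 'I_(size D) => 'X_[cone_base (nth [::] D i)])
    (fun i => cone_vars (nth [::] D i)).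
Proof.
move=> MP sD covD.
pose c (i : 'I_(size D)) : cone := nth [::] D i.
have sc i : size (c i) = n by apply: sD; exact: mem_nth.
have cP i m : in_cone (c i) m -> P m.
  move=> cim; rewrite -(lt0b (P m)) -covD covering_sum (bigD1 i) //=.
  by rewrite (cim : in_cone (nth [::] D i) m = true).
split=> [i|f Mf].
  apply: stanley_space_cone (sc i) _ => f fc.
  by apply/MP => m /fc /cP.
exists [ffun i => msupp_part (fun m => in_cone (c i) m) f]; split.
  split=> [i|].
    rewrite ffunE; apply/(zspace_cone _ (sc i)) => m.
    by rewrite mcoeff_msupp mcoeff_msupp_part; case: in_cone; rewrite ?mulr0n ?eqxx.
  apply/mpolyP => m; rewrite raddf_sum /=.
  under eq_bigr => i _ do rewrite ffunE mcoeff_msupp_part.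
  rewrite sumrMnr -covering_sum covD.
  have [mf|/memN_msupp_eq0 ->] := boolP (m \in msupp f); last by rewrite mul0rn.
  by rewrite ((MP f).1 Mf m mf).
move=> w [wc fE]; apply/ffunP => i; rewrite ffunE; apply/mpolyP => m.
have w0 j : ~~ in_cone (c j) m -> (w j)@_m = 0.
  move=> jm; apply: memN_msupp_eq0; apply: contra jm.
  by have /(zspace_cone _ (sc j)) := wc j; apply.
rewrite mcoeff_msupp_part; case: (boolP (in_cone (c i) m)) => cim; last first.
  by rewrite w0.
rewrite mulr1n fE raddf_sum (bigD1 i) //= big1 ?addr0 // => j ji.
apply: w0; apply/negP => cjm.
(* Otherwise [m] would be counted twice, for [i] and for [j]. *)
have := covD m; rewrite covering_sum (bigD1 i) //= (bigD1 j) //=.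
rewrite (cim : in_cone (nth [::] D i) m = true).
by rewrite (cjm : in_cone (nth [::] D j) m = true); case: (P m); lia.
Qed.

Lemma sdepth_ge (M : set S) s (z : 'I_s -> S) (Z : 'I_s -> {set 'I_n}) d :
    stanley_decomposition M z Z -> (d <= n)%N ->
    (forall i, d <= #|Z i|)%N ->
  (d <= sdepth M)%N.
Proof.
move=> dec dn dZ.
have le_n : (sdepth_decomposition Z < n.+1)%N.
  rewrite ltnS /sdepth_decomposition; elim/big_ind: _ => // [x y xn _|i _].
    by rewrite geq_min xn.
  by rewrite -[leqRHS]card_ord max_card.
apply: (@leq_trans (Ordinal le_n)); last first.
  by apply: leq_bigmax_cond; apply/asboolP; exists s, z, Z.
rewrite /= /sdepth_decomposition; elim/big_ind: _ => // x y dx dy.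
by rewrite leq_min dx.
Qed.

End StanleySpaces.

(** * Irreducible monomial ideals *)

Section IrreducibleIdeals.
Variables (K : fieldType) (n : nat).
Local Notation S := {mpoly K[n]}.
Implicit Types (m : 'X_{1..n}) (f : S).

Definition power_ideal (A : {set 'I_n}) (e : 'I_n -> nat) : set S :=
  ideal_span [set g | exists2 i, i \in A & g = 'X_i ^+ e i].

Lemma power_idealP (A : {set 'I_n}) (e : 'I_n -> nat) f :
  power_ideal A e f <->
  forall m, m \in msupp f -> [exists i in A, (e i <= m i)%N].
Proof.
split=> [[k [a [g [gP ->]]]] m|fP].
  move=> /msupp_sum_le /flatten_mapP[j _]; have [i iA ->] := gP j.
  rewrite mpolyXn (perm_mem (msuppMX _ _)) => /mapP[m' _ ->].
  apply/exists_inP; exists i => //.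
  by rewrite mnmDE mulmnE mnm1E eqxx mul1n leq_addr.
pose mon (j : 'I_(size (msupp f))) := nth 0%MM (msupp f) j.
have [h hA he] : exists2 h, forall j, h j \in A & forall j, (e (h j) <= mon j (h j))%N.
  apply: (@fin_all_exists2 _ (fun=> 'I_n) (fun _ i => i \in A)
    (fun j i => (e i <= mon j i)%N)) => j.
  by apply/exists_inP/fP; rewrite mem_nth.
exists (size (msupp f)), (fun j => f@_(mon j) *: 'X_[mon j - U_(h j) *+ e (h j)]).
exists (fun j => 'X_(h j) ^+ e (h j)); split=> [j|]; first by exists (h j).
rewrite {1}[f]mpolyE (big_nth 0%MM) big_mkord; apply: eq_bigr => j _.
rewrite mpolyXn -scalerAl -mpolyXD submK //; apply/mnm_lepP => i.
rewrite mulmnE mnm1E; case: eqP => [<-|_]; last by rewrite mul0n.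
by rewrite mul1n.
Qed.

Lemma power_ideal_monomial (A : {set 'I_n}) (e : 'I_n -> nat) m :
  power_ideal A e 'X_[m] <-> exists2 i, i \in A & (e i <= m i)%N.
Proof.
rewrite power_idealP; split=> [/(_ m)|[i iA im] m'].
  by rewrite msuppX mem_head => /(_ isT)/exists_inP.
by rewrite msuppX inE => /eqP ->; apply/exists_inP; exists i.
Qed.

Lemma var_ideal_power (A : {set 'I_n}) :
  @var_ideal K n A = power_ideal A (fun=> 1%N).
Proof. by []. Qed.

(** Taking radicals forgets the exponents, and a variable lies in an ideal generated
    by variables only if it is one of them. *)
Lemma radical_power_ideal (A T : {set 'I_n}) (e : 'I_n -> nat) :
    (forall i, i \in A -> (0 < e i)%N) ->
    radical (power_ideal A e) = @var_ideal K n T -> A = T.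
Proof.
move=> e_gt0 radA.
have memT i : i \in T <-> radical (power_ideal A e) 'X_i.
  rewrite radA var_ideal_power power_ideal_monomial; split=> [iT|[j jT]].
    by exists i; rewrite // mnm1E eqxx.
  by rewrite mnm1E; case: eqP => // ->.
apply/setP => i; apply/idP/idP => [iA|/memT[k]].
  apply/memT; exists (e i).-1; rewrite prednK ?e_gt0 //.
  by rewrite mpolyXn power_ideal_monomial; exists i; rewrite // mulmnE mnm1E eqxx mul1n.
rewrite mpolyXn power_ideal_monomial => -[j jA].
rewrite mulmnE mnm1E; case: eqP => [-> //|_].
by rewrite mul0n leqNgt e_gt0.
Qed.

(** Junk value [0] at indices [>= n], so that the bounds can be listed over ranges
    of natural numbers. *)
Definition exponents (e : 'I_n -> nat) (a k : nat) : seq nat :=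
  [seq oapp e 0%N (insub j) | j <- iota a k].

Lemma exponents_cat e a k l :
  exponents e a k ++ exponents e (a + k) l = exponents e a (k + l).
Proof. by rewrite /exponents iotaD map_cat. Qed.

Lemma size_exponents e a k : size (exponents e a k) = k.
Proof. by rewrite size_map size_iota. Qed.

Lemma meets_exponents e a k m : (a + k <= n)%N ->
  meets (exponents e a k) (take k (drop a m)) =
  [exists i in [set i : 'I_n | (a <= i < a + k)%N]%SET, (e i <= m i)%N].
Proof.
move=> akn; rewrite -(map_nth_iota 0%N); last by rewrite size_tuple; lia.
rewrite /meets zip_map has_map; apply/hasP/exists_inP => [[j]|[i]].
  rewrite mem_iota => jak; have jn : (j < n)%N by lia.
  rewrite /reaches /= (insubT (fun j => j < n)%N jn) /= => ej.
  by exists (Ordinal jn); rewrite ?inE //= (mnm_nth 0).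
rewrite inE => iak eim; exists (i : nat); first by rewrite mem_iota.
by rewrite /reaches /= valK /= -mnm_nth.
Qed.

End IrreducibleIdeals.

(** * The lower bound *)

Lemma ceil_half (k : nat) : Num.ceil (k%:R / 2 : rat) <= (uphalf k)%:Z.
Proof.
rewrite ceil_le_int ler_pdivrMr // -pmulrn -natrM ler_nat.
lia.
Qed.

Theorem lemma4p3 (K : fieldType) (n : nat) (Q Q' : set {mpoly K[n]})
    (r t p : nat)
    (Qirr : irreducible_monomial_ideal Q)
    (Q'irr : irreducible_monomial_ideal Q')
    (Qneq0 : exists2 f, Q f & f != 0)
    (Q'neq0 : exists2 f, Q' f & f != 0)
    (radQ : radical Q = var_ideal [set i : 'I_n | (i < t)%N]%SET)
    (radQ' : radical Q' = var_ideal [set i : 'I_n | (r <= i < p)%N]%SET)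
    (rtp : [\/ [/\ (1 <= r)%N, (r <= t)%N, (t < p)%N & (p <= n)%N],
               [/\ r = 0%N, (0 < t)%N, (t < p)%N & (p <= n)%N] |
               [/\ (1 <= r)%N, (r <= t)%N, t = p & (p <= n)%N]])
    (pn : p = n) :
  Num.ceil (r%:R / 2 : rat) + Num.ceil ((n%:R - t%:R) / 2 : rat)
    <= (sdepth (Q `&` Q'))%:Z.
Proof.
have [rt tn] : (r <= t)%N /\ (t <= n)%N by case: rtp => -[]; lia.
case: Qirr => A [e [e_gt0 QE]]; case: Q'irr => A' [e' [e'_gt0 Q'E]].
rewrite -/(power_ideal A e) in QE; rewrite -/(power_ideal A' e') in Q'E.
subst Q Q' p.
have {radQ} AE := radical_power_ideal e_gt0 radQ.
have {radQ'} A'E := radical_power_ideal e'_gt0 radQ'.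
pose eA := exponents e 0 r; pose eB := exponents e r (t - r).
pose eB' := exponents e' r (t - r); pose eC := exponents e' t (n - t).
have sB : size eB' = size eB by rewrite !size_exponents.
pose D := intersection_cones eA eB eB' eC.
have dec := @stanley_decomposition_cones K n
  (power_ideal A e `&` power_ideal A' e')
  (fun m => [exists i in A, (e i <= m i)%N] &&
            [exists i in A', (e' i <= m i)%N]) D.
rewrite -natrB //; apply: le_trans (lerD (ceil_half r) (ceil_half (n - t))) _.
rewrite -PoszD lez_nat; apply: sdepth_ge; first apply: dec.
- move=> f; split=> [[/power_idealP fQ /power_idealP fQ'] m mf|fP].
    by rewrite fQ ?fQ'.
  by split; apply/power_idealP => m /fP /andP[].
- by move=> c /(intersection_cones_dim sB)[-> _]; rewrite !size_exponents; lia.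
- move=> m; rewrite covering_intersection ?size_exponents ?size_tuple //; last lia.
  have -> : eA ++ eB = exponents e 0 (r + (t - r)) by rewrite -exponents_cat.
  have -> : eB' ++ eC = exponents e' r (t - r + (n - t)).
    by rewrite -exponents_cat subnKC.
  rewrite -[X in meets _ (take _ X)]drop0 meets_exponents; last by lia.
  rewrite -[drop r m](@take_oversize _ (t - r + (n - t))); last first.
    by rewrite size_drop size_tuple; lia.
  rewrite meets_exponents; last by lia.
  rewrite AE A'E; congr (nat_of_bool (_ && _)).
    by apply: eq_existsb => i; rewrite !inE; lia.
  by apply: eq_existsb => i; rewrite !inE; lia.
- by lia.
move=> i; have /(intersection_cones_dim sB)[sc] := mem_nth [::] (ltn_ord i).
rewrite card_cone_vars; first by rewrite !size_exponents.
by rewrite sc !size_exponents; lia.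
Qed.
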